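(* Let $\sigma=0.64368\ldots$ be the unique positive solution of $32s^3-32s^2+12s-3=0$. Then $\mathrm{OneMinM}_\sigma=0$.
   Context: $O=(0,0)$, $|\cdot|$ is the Euclidean norm, $B_\tau(q)\subseteq\mathbb R^2$ is the open disk of radius $\tau$ centered at $q$, and $B_0(q):=\emptyset$. Let $\sigma\in[\frac12,1]$. For $P\subseteq\mathbb R^2$ let $\mathcal R(P)$ be the set of functions $r:P\to[0,1]$ such that $r(p)>0$ for at most finitely many $p\in P$ and $B_{r(p)}(p)\cap B_{r(p')}(p')=\emptyset$ for all distinct $p,p'\in P$. For $r\in\mathcal R(P)$ set $U(P,r):=\bigcup_{p\in P}B_{r(p)}(p)$ and $R(P,r):=\inf\{R>0: B_R(O)\supset U(P,r)\}$, with the convention $\mathrm{diam}(U(P,r))=R(P,r)=0$ if $r\equiv0$. Define $$F_\sigma(P,r):=\sum_{p\in P}r(p)-\tfrac1{2\sigma}\min\{\mathrm{diam}(U(P,r)),\tfrac12+R(P,r)\},\qquad M_\sigma(P):=\sup\{F_\sigma(P,r): r\in\mathcal R(P)\}\in[0,+\infty].$$ For $p\in\mathbb R^2$, $0<r\le1$, $\Delta_\sigma(p,r)$ is the set of pairs $(q_1,q_2)\in\overline{B_r(p)}\times\overline{B_r(p)}$ with $|q_1-q_2|\ge2\sigma r$. For $L>1$, a set $P\subseteq\mathbb R^2$ is $(\sigma,L)$-one-stable if for every $p\in P\cap B_L(O)$ there is $(q_1,q_2)\in\Delta_\sigma(p,1)$ with $q_1,q_2\in P$. Set $$\mathrm{OneMinM}_\sigma(L):=\inf\{M_\sigma(P):P\text{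 is }(\sigma,L)\text{-one-stable and }O\in P\},\qquad \mathrm{OneMinM}_\sigma:=\lim_{L\to\infty}\mathrm{OneMinM}_\sigma(L),$$ the limit existing by monotonicity in $L$. *)

(* Defs.v *)
From HB Require Import structures.
From mathcomp Require Import all_boot all_order all_algebra.
From mathcomp Require Import all_classical all_reals all_analysis.
From mathcomp Require Import ring lra.

Set Implicit Arguments.
Unset Strict Implicit.
Unset Printing Implicit Defensive.
Import Order.TTheory GRing.Theory Num.Theory.
Import numFieldTopology.Exports numFieldNormedType.Exports.

Local Open Scope classical_set_scope.
Local Open Scope ring_scope.

Section Defs.
Variable R : realType.

Local Notation plane := (R * R)%type.

Implicit Types (P A : set plane) (r : plane -> R) (p q : plane).

(* The library norm on R * R is the sup norm, hence this separate definition. *)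
Definition enorm p : R := Num.sqrt (p.1 ^+ 2 + p.2 ^+ 2).

Definition disk q (t : R) : set plane := [set x | enorm (x - q) < t].

Definition cdisk q (t : R) : set plane := [set x | enorm (x - q) <= t].

(* A function P -> [0,1] is represented by a total function on the plane, of
   which only the values on P are ever used. *)
Definition admissible P r : Prop :=
  [/\ forall p, P p -> 0 <= r p <= 1,
      finite_set [set p | P p /\ 0 < r p] &
      forall p q, P p -> P q -> p <> q -> disk p (r p) `&` disk q (r q) = set0].

Definition disk_union P r : set plane := \bigcup_(p in P) disk p (r p).

Definition ediam A : R := sup [set enorm (x - y) | x in A & y in A].

Definition origin_radius A : R := inf [set t | 0 < t /\ A `<=` disk 0 t].

Definition F (sigma : R) P r : R :=
  \sum_(p \in P) r p -
  (2 * sigma)^-1 * Num.min (ediam (disk_union P r))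
                           (2^-1 + origin_radius (disk_union P r)).

Definition M (sigma : R) P : \bar R :=
  ereal_sup [set (F sigma P r)%:E | r in admissible P].

Definition Delta (sigma : R) p (t : R) : set (plane * plane) :=
  [set q | [/\ cdisk p t q.1, cdisk p t q.2 &
               2 * sigma * t <= enorm (q.1 - q.2)]].

Definition one_stable (sigma L : R) P : Prop :=
  forall p, P p -> disk 0 L p ->
    exists q : plane * plane, [/\ Delta sigma p 1 q, P q.1 & P q.2].

(* Only L > 1 is meaningful; the restriction is immaterial in the limit. *)
Definition OneMinM_at (sigma L : R) : \bar R :=
  ereal_inf [set M sigma P | P in [set P | one_stable sigma L P /\ P 0]].

Definition OneMinM (sigma : R) : \bar R :=
  lim (OneMinM_at sigma L @[L --> +oo]).

(* [lim] is meaningful here: the limit exists. *)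
Lemma OneMinM_cvg (sigma : R) :
  OneMinM_at sigma L @[L --> +oo] --> OneMinM sigma.
Proof.
apply: nondecreasing_is_cvge => L L' LL'.
apply: ereal_inf_le_tmp => _ [P [sP P0] <-]; exists P => //; split=> // p Pp Lp.
by apply: sP => //; exact: lt_le_trans LL'.
Qed.

(* The conventions for r = 0 hold by definition of [sup] and [inf]. *)
Lemma disk_union0 P r : (forall p, P p -> r p = 0) -> disk_union P r = set0.
Proof.
move=> r0; rewrite -subset0 => x [p Pp]; rewrite /disk/= r0//.
by rewrite ltNge sqrtr_ge0.
Qed.

Lemma ediam0 : ediam set0 = 0.
Proof.
rewrite /ediam (_ : [set _ | _ in _ & _ in _] = set0) ?sup0//.
by rewrite -subset0 => x [? []].
Qed.

Lemma origin_radius0 : origin_radius set0 = 0.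
Proof.
rewrite /origin_radius; set S := [set _ | _].
have S1 : S 1 by split.
have lS : lbound S 0 by move=> x [/ltW].
have iS : has_inf S by split; [exists 1|exists 0].
apply/eqP; rewrite eq_le; apply/andP; split;
  last exact: lb_le_inf (ex_intro _ 1 S1) lS.
rewrite leNgt; apply/negP => i0.
have : inf S <= inf S / 2 by apply: ge_inf; [case: iS|split=> //; lra].
lra.
Qed.

(* The bounds say 0.64368 <= s < 0.64369. *)
Lemma cubic_unique_root : exists s : R,
  (64 + 368 / 1000) / 100 <= s < (64 + 369 / 1000) / 100 /\
  unique (fun s => 0 < s /\ 32 * s ^+ 3 - 32 * s ^+ 2 + 12 * s - 3 = 0) s.
Proof.
pose p : {poly R} := 32%:P * 'X ^+ 3 - 32%:P * 'X ^+ 2 + 12%:P * 'X - 3%:P.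
have pE x : p.[x] = 32 * x ^+ 3 - 32 * x ^+ 2 + 12 * x - 3 by rewrite /p !hornerE.
have [||s /andP[sa sb]] :=
  @poly_ivt R p ((64 + 368 / 1000) / 100) ((64 + 369 / 1000) / 100).
- lra.
- by rewrite !pE; apply/andP; split; lra.
rewrite /root pE => /eqP s0.
have sN : s != (64 + 369 / 1000) / 100.
  by apply/eqP => sE; move: s0; rewrite sE; lra.
exists s; split; first by rewrite sa lt_neqAle sN sb.
split; first by split=> //; lra.
move=> t [t0 tE]; apply/eqP; rewrite -subr_eq0.
have : (s - t) * (32 * (s ^+ 2 + s * t + t ^+ 2) - 32 * (s + t) + 12) = 0.
  by rewrite -[RHS](subrr 0) -{1}s0 -tE; ring.
move/eqP; rewrite mulf_eq0 => /orP[//|/eqP K]; exfalso.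
have : 0 <= (s - t) ^+ 2 by exact: sqr_ge0.
have : 0 <= (s + t - 2 / 3) ^+ 2 by exact: sqr_ge0.
nra.
Qed.

End Defs.

(* Main.v *)
Require Import Defs.
From mathcomp Require Import all_boot all_order all_algebra.
From mathcomp Require Import all_classical all_reals all_analysis.
From mathcomp Require Import ring lra.
Import Order.TTheory GRing.Theory Num.Theory.
Local Open Scope classical_set_scope.
Local Open Scope ring_scope.

(**
With s = 2 sigma, the extremal set is an isosceles trapezoid ABCD with A = O,
legs |AB| = |CD| = 1, bases |AD| = x = 2 - s and |BC| = y, and both diagonals
equal to s; since all sides are at most 1, the two neighbours of each vertex
make it one-stable for every L. Let a, b, c, d be the radii at the vertices.
When all four are positive, a + d <= x and b + c <= y, while
diam >= s + max(a + c, b + d) >= s + (a + b + c + d) / 2 and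
R >= max(1 + b, s + c) >= (1 + s + b + c) / 2; this gives
s (a + b + c + d) <= diam and <= 1/2 + R as soon as (s - 1/2)(x + y) <= s and
s x + (s - 1/2) y <= 1 + s/2. Requiring equality in both determines x and y,
and Ptolemy's relation x y = s^2 - 1 then becomes the cubic equation for sigma.
When some radii vanish, the bounds are not tight.
*)

(** * Linear inequalities for the radii at the four vertices *)

Ltac split_support a :=
  match goal with H : is_true (0 <= a) |- _ =>
    move: (H); rewrite le_eqVlt => /predU1P[?|?]; [subst a|]
  end.

Ltac use_positivity := repeat match goal with
  | H : is_true (0 < ?a) -> _, K : is_true (0 < ?a) |- _ => have {}H := H K
  | H : is_true (0 < 0) -> _ |- _ => clear H
  | H : is_true (0 < _) -> is_true (0 < 0) -> _ |- _ => clear H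
  end.

(* A disk of radius 0 is empty and constrains nothing, whence the positivity
   premises; in particular a radius may exceed the distance to a vertex of
   radius 0. *)
Lemma quad_diam_bound (R : realFieldType) (s x y a b c d T : R) :
  1 <= s -> s <= 2 -> x <= 1 -> y <= 1 -> (s - 2^-1) * (x + y) <= s ->
  0 <= a -> 0 <= b -> 0 <= c -> 0 <= d -> 0 <= T ->
  (0 < a -> 0 < b -> a + b <= 1) -> (0 < c -> 0 < d -> c + d <= 1) ->
  (0 < a -> 0 < d -> a + d <= x) -> (0 < b -> 0 < c -> b + c <= y) ->
  (0 < a -> 0 < c -> a + c <= s) -> (0 < b -> 0 < d -> b + d <= s) ->
  (0 < a -> 2 * a <= T) -> (0 < b -> 2 * b <= T) ->
  (0 < c -> 2 * c <= T) -> (0 < d -> 2 * d <= T) ->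
  (0 < a -> 0 < b -> 1 + (a + b) <= T) -> (0 < c -> 0 < d -> 1 + (c + d) <= T) ->
  (0 < a -> 0 < d -> x + (a + d) <= T) -> (0 < b -> 0 < c -> y + (b + c) <= T) ->
  (0 < a -> 0 < c -> s + (a + c) <= T) -> (0 < b -> 0 < d -> s + (b + d) <= T) ->
  s * (a + b + c + d) <= T.
Proof.
move=> s1 s2 x1 y1 sxy a0 b0 c0 d0 T0 ab cd ad bc.
(* [lra] treats products such as [s * a] as atoms, so the products of [s] or [s - 1] with the
   constraints are supplied beforehand. *)
have s2M u : 0 <= u -> s * u <= 2 * u by move=> ?; exact: ler_wpM2r.
have [s2a s2b s2c s2d] := And4 (s2M _ a0) (s2M _ b0) (s2M _ c0) (s2M _ d0).
have s1M u : u <= 1 -> (s - 1) * u <= s - 1.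
  by move=> ?; rewrite -[leRHS]mulr1 ler_wpM2l// subr_ge0.
have sab p q := s1M (a + b) (ab p q).
have scd p q := s1M (c + d) (cd p q).
have sad p q := s1M (a + d) (le_trans (ad p q) x1).
have sbc p q := s1M (b + c) (le_trans (bc p q) y1).
(* Needed when all four radii are positive: the two diagonal bounds average to
   [s + (a + b + c + d) / 2 <= T]. *)
have sS : 0 < a -> 0 < d -> 0 < b -> 0 < c ->
    (s - 2^-1) * ((a + d) + (b + c)) <= s.
  move=> *; apply: le_trans sxy; apply: ler_wpM2l; first lra.
  by apply: lerD; [exact: ad|exact: bc].
move=> *; clear s2M s1M sxy.
split_support a; split_support b; split_support c; split_support d;
  use_positivity; lra.
Qed.

(** For four positive radii, averaging [1 + b <= T] and [s + c <= T] reduces the claim to [s * x +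
    (s - 2^-1) * (b + c) <= 1 + s / 2], tight at [b + c = y]. Smaller supports rest on the numerical
    bounds: a lone [a], for instance, needs [(s - 1) * a <= 2^-1]. *)
Lemma quad_radius_bound (R : realFieldType) (s x y a b c d T : R) :
  5 / 4 <= s <= 13 / 10 -> x = 2 - s ->
  s * x + (s - 2^-1) * y = 1 + s / 2 -> y <= 19 / 20 ->
  0 <= a <= 1 -> 0 <= b <= 1 -> 0 <= c <= 1 -> 0 <= d <= 1 -> 0 <= T ->
  (0 < a -> 0 < b -> a + b <= 1) -> (0 < c -> 0 < d -> c + d <= 1) ->
  (0 < a -> 0 < d -> a + d <= x) -> (0 < b -> 0 < c -> b + c <= y) ->
  (0 < a -> 0 < c -> a + c <= s) -> (0 < b -> 0 < d -> b + d <= s) ->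
  (0 < a -> a <= T) -> (0 < b -> 1 + b <= T) ->
  (0 < c -> s + c <= T) -> (0 < d -> x + d <= T) ->
  s * (a + b + c + d) <= 2^-1 + T.
Proof.
move=> /andP[s1 s2] xE xyE y2.
move=> /andP[a0 a1] /andP[b0 b1] /andP[c0 c1] /andP[d0 d1] T0 ab cd ad bc ac bd.
have sM u v : u <= v -> (s - 1) * u <= (s - 1) * v.
  by move=> ?; apply: ler_wpM2l => //; lra.
have [sa sb sc sd] := And4 (sM _ _ a0) (sM _ _ b0) (sM _ _ c0) (sM _ _ d0).
have [ta tb tc td] := And4 (sM _ _ a1) (sM _ _ b1) (sM _ _ c1) (sM _ _ d1).
(* These bound the monomials [s * y] and [s ^+ 2] linearly. *)
have [sy ss1 ss2] := And3 (sM _ _ y2) (sM _ _ s1) (sM _ _ s2).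
have sab p q := sM _ _ (ab p q).
have scd p q := sM _ _ (cd p q).
have sad p q := sM _ _ (ad p q).
have sbc p q := sM _ _ (bc p q).
have sac p q := sM _ _ (ac p q).
have sbd p q := sM _ _ (bd p q).
move=> *; subst x; clear sM.
split_support a; split_support b; split_support c; split_support d;
  use_positivity; lra.
Qed.

(** * Euclidean norm, rays and disjoint disks *)

Section Disks.
Variable R : realType.
Local Notation plane := (R * R)%type.
Implicit Types (p q u v : plane) (r : plane -> R) (P A : set plane) (k t th : R).

Lemma enormE v t : 0 <= t -> v.1 ^+ 2 + v.2 ^+ 2 = t ^+ 2 -> enorm v = t.
Proof. by move=> t0; rewrite /enorm => ->; rewrite sqrtr_sqr ger0_norm. Qed.

Lemma enorm_ge0 v : 0 <= enorm v.
Proof. exact: sqrtr_ge0. Qed.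

Lemma sqr_enorm v : enorm v ^+ 2 = v.1 ^+ 2 + v.2 ^+ 2.
Proof. by rewrite sqr_sqrtr// addr_ge0 ?sqr_ge0. Qed.

Lemma enorm0 : enorm (0 : plane) = 0.
Proof. by apply: enormE => //=; ring. Qed.

Lemma enormBC p q : enorm (p - q) = enorm (q - p).
Proof. by rewrite /enorm/=; congr Num.sqrt; ring. Qed.

Lemma enormD u v : enorm (u + v) <= enorm u + enorm v.
Proof.
have [u0 v0] := (enorm_ge0 u, enorm_ge0 v).
rewrite -[leRHS]ger0_norm ?addr_ge0// -sqrtr_sqr ler_wsqrtr//=.
rewrite [leRHS]sqrrD !sqr_enorm.
suff : u.1 * v.1 + u.2 * v.2 <= enorm u * enorm v by lra.
apply: le_trans (ler_norm _) _.
rewrite -[leRHS]ger0_norm ?mulr_ge0// -!sqrtr_sqr ler_wsqrtr// exprMn !sqr_enorm.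
have := sqr_ge0 (u.1 * v.2 - u.2 * v.1); lra.
Qed.

Lemma enorm_eq0 v : enorm v = 0 -> v = 0.
Proof.
move=> v0; have := sqr_enorm v; rewrite v0 expr0n/= => /esym/eqP.
rewrite paddr_eq0 ?sqr_ge0// !sqrf_eq0 => /andP[/eqP v1 /eqP v2].
by rewrite [v]surjective_pairing v1 v2.
Qed.

Definition ray p t u : plane := (p.1 + t * u.1, p.2 + t * u.2).

Lemma ray0 p u : ray p 0 u = p.
Proof. by rewrite /ray !mul0r !addr0 -surjective_pairing. Qed.

(** Puts both points on one line, where distances are absolute values. If they coincide, any
    direction serves, so concentric disks need no separate treatment later. *)
Lemma ray_unit p q : exists u, enorm u = 1 /\ p = ray q (enorm (p - q)) u.
Proof.
have [pq|pq] := eqVneq (enorm (p - q)) 0.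
  exists (1, 0); split; first by apply: enormE => //=; ring.
  by rewrite pq (subr0_eq (enorm_eq0 _ pq)) ray0.
exists ((enorm (p - q))^-1 * (p.1 - q.1), (enorm (p - q))^-1 * (p.2 - q.2)).
split; last by rewrite [LHS]surjective_pairing; congr pair => /=; field.
apply: enormE => //=; rewrite !exprMn -mulrDr -[X in _ * X](sqr_enorm (p - q)).
by rewrite -exprMn mulVf.
Qed.

Lemma enorm_ray p k t u : enorm u = 1 -> enorm (ray p k u - ray p t u) = `|k - t|.
Proof.
move=> u1; apply: enormE; rewrite ?normr_ge0//= real_normK ?num_real//.
have := sqr_enorm u; rewrite u1 expr1n => u2.
by rewrite -[RHS]mulr1 u2; ring.
Qed.

(** Otherwise the point dividing the segment between the centres in the ratio of the radii would lie
    in both disks. *)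
Lemma disjoint_disks_le p q k t : 0 < k -> 0 < t ->
  disk p k `&` disk q t = set0 -> k + t <= enorm (p - q).
Proof.
move=> k0 t0 pq0; rewrite leNgt; apply/negP => lt_pq.
have [u [u1 pE]] := ray_unit p q.
have d0 := enorm_ge0 (p - q); move: pE d0 lt_pq; set d := enorm _ => pE d0 lt_pq.
have kt0 : 0 < k + t by exact: addr_gt0.
have fE : k / (k + t) + t / (k + t) = 1 by rewrite -mulrDl divff// gt_eqF.
have f0 : 0 < k / (k + t) by exact: divr_gt0.
have g0 : 0 < t / (k + t) by exact: divr_gt0.
have dlt : d / (k + t) < 1 by rewrite ltr_pdivrMr ?mul1r.
suff : (disk p k `&` disk q t) (ray q (t / (k + t) * d) u) by rewrite pq0.
rewrite /disk/=; split.
  rewrite {1}pE enorm_ray// -/d.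
  have -> : t / (k + t) * d - d = - (k * (d / (k + t))).
    by rewrite -[X in _ - X]mul1r -fE; ring.
  rewrite normrN ger0_norm ?mulr_ge0 ?invr_ge0 ?(ltW k0) ?(ltW kt0)//.
  by rewrite -[ltRHS]mulr1 ltr_pM2l.
rewrite -[X in _ - X](ray0 q u) enorm_ray// subr0 ger0_norm; last first.
  by apply: mulr_ge0; rewrite // ltW.
by rewrite -mulrA (mulrC _ d) -[ltRHS]mulr1 ltr_pM2l.
Qed.

(** Open disks do not attain their extreme points; these are approached by scaling the radii by
    [th < 1]. *)
Lemma le_of_shrink (d e T : R) :
  0 <= e -> (forall th, 0 <= th < 1 -> d + th * e <= T) -> d + e <= T.
Proof.
move=> e0 h; rewrite leNgt; apply/negP => lt_T.
have dT : d <= T by have := h 0; rewrite mul0r addr0; apply; rewrite lexx ltr01.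
have {}e0 : 0 < e by lra.
(* The midpoint of [(T - d) / e] and 1; it gives [d + th * e = (T + d + e) / 2 > T]. *)
have := h ((T - d + e) / (2 * e)).
have -> : (T - d + e) / (2 * e) * e = (T - d + e) / 2 by field; rewrite gt_eqF.
have e20 : 0 < 2 * e by lra.
rewrite divr_ge0 ?ltr_pdivrMr//=; [|lra|lra].
have -> : T - d + e < 1 * (2 * e) by lra.
by move=> /(_ isT); lra.
Qed.

Lemma norm_shrink_lt th k : 0 <= th -> th < 1 -> 0 < k -> `|th * k| < k.
Proof.
move=> th0 th1 k0; rewrite ger0_norm; last by apply: mulr_ge0; rewrite // ltW.
by rewrite -[ltRHS]mul1r ltr_pM2r.
Qed.

Lemma disk_ray p k t u : enorm u = 1 -> `|t| < k -> disk p k (ray p t u).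
Proof.
by move=> u1 tk; rewrite /disk/= -[X in _ - X](ray0 p u) enorm_ray// subr0.
Qed.

(** * Diameter and origin radius of a bounded set *)

Definition bounded_plane A := exists2 K, 0 < K & A `<=` disk 0 K.

(** Boundedness matters: [sup] of a set without upper bound is 0 by default. *)
Lemma ediam_ub A x y : bounded_plane A -> A x -> A y -> enorm (x - y) <= ediam A.
Proof.
move=> [K K0 AK] Ax Ay; apply: ub_le_sup; last by exists x => //; exists y.
exists (K + K) => _ [v Av [w Aw <-]].
have -> : v - w = (v - 0) + (0 - w) by rewrite subr0 sub0r.
apply: le_trans (enormD _ _) _; rewrite (enormBC 0 w).
by apply: lerD; exact/ltW/AK.
Qed.

(** On the line through the centres, take one point in each disk, pushed outwards in opposite
    directions. The case [p = q] gives the diameter of a single disk. *)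
Lemma ediam_disks A p q k t : bounded_plane A -> 0 < k -> 0 < t ->
  disk p k `<=` A -> disk q t `<=` A -> enorm (p - q) + (k + t) <= ediam A.
Proof.
move=> bA k0 t0 pA qA; apply: le_of_shrink => [|th /andP[th0 th1]].
  by rewrite addr_ge0 ?ltW.
have [u [u1 pE]] := ray_unit p q.
have d0 := enorm_ge0 (p - q); move: pE d0; set d := enorm _ => pE d0.
have thk : `|th * k| < k by exact: norm_shrink_lt.
have tht : `|- (th * t)| < t by rewrite normrN norm_shrink_lt.
have := ediam_ub _ _ _ bA (pA _ (disk_ray p _ _ _ u1 thk))
  (qA _ (disk_ray q _ _ _ u1 tht)).
have -> : ray p (th * k) u = ray q (d + th * k) u.
  by rewrite pE /ray/=; congr pair; ring.
rewrite enorm_ray// ger0_norm; last first.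
  by have := mulr_ge0 th0 (ltW k0); have := mulr_ge0 th0 (ltW t0); lra.
by move=> h; lra.
Qed.

(** The disk reaches farthest from the origin along the ray through its centre. *)
Lemma origin_radius_disk A p k : bounded_plane A -> 0 < k ->
  disk p k `<=` A -> enorm p + k <= origin_radius A.
Proof.
move=> [K K0 AK] k0 pA; apply: lb_le_inf; first by exists K.
move=> T [T0 AT]; apply: le_of_shrink; first exact: ltW.
move=> th /andP[th0 th1].
have [u [u1]] := ray_unit p 0; rewrite subr0 => pE.
have thk : `|th * k| < k by exact: norm_shrink_lt.
have := AT _ (pA _ (disk_ray p _ _ _ u1 thk)).
rewrite /disk/=.
have -> : ray p (th * k) u = ray 0 (enorm p + th * k) u.
  by rewrite {1}pE /ray/=; congr pair; ring.
rewrite -[X in _ - X](ray0 0 u) enorm_ray// subr0 ger0_norm; first exact: ltW.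
by rewrite addr_ge0 ?enorm_ge0 ?mulr_ge0// ltW.
Qed.

Lemma bounded_disk_union (s : seq plane) r :
  (forall p, p \in s -> r p <= 1) ->
  bounded_plane (disk_union [set` s] r).
Proof.
move=> r1; exists (\sum_(p <- s) enorm p + 1).
  by rewrite ltr_wpDl// sumr_ge0// => p _; exact: enorm_ge0.
move=> x [p /= ps]; rewrite /disk/= subr0 => xp.
have -> : x = p + (x - p) by rewrite addrC subrK.
apply: le_lt_trans (enormD _ _) _; apply: ler_ltD; last exact: lt_le_trans (r1 p ps).
by rewrite (big_rem p)//= lerDl sumr_ge0// => ? _; exact: enorm_ge0.
Qed.

(** * Reduction to a suitable set for each [L], and to distances between centres *)

Lemma M_ge0 sigma P : (0 <= M sigma P)%E.
Proof.
(* The zero radius function is admissible and has value 0. *)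
apply: ereal_sup_ubound; exists (fun=> 0).
  split=> [p _|//|p q _ _ _]; first by rewrite lexx ler01.
    by rewrite (_ : [set _ | _] = set0)// -subset0 => p [_]; rewrite ltxx.
  by rewrite -subset0 => x [+ _]; rewrite /disk/= ltNge enorm_ge0.
rewrite /F fsbig1// disk_union0// ediam0 origin_radius0 addr0.
by rewrite (_ : Num.min 0 _ = 0) ?mulr0 ?subr0//; apply/min_idPl; lra.
Qed.

Lemma F_le0 sigma P r : 0 < sigma ->
  2 * sigma * (\sum_(p \in P) r p) <= ediam (disk_union P r) ->
  2 * sigma * (\sum_(p \in P) r p) <= 2^-1 + origin_radius (disk_union P r) ->
  F sigma P r <= 0.
Proof.
move=> s0 hd hR; rewrite /F subr_le0 mulrC ler_pdivlMr ?mulr_gt0//.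
by rewrite mulrC le_min hd hR.
Qed.

(** As [M] is never negative, such sets force [OneMinM_at sigma] to be constantly 0. *)
Lemma OneMinM_eq0 sigma :
  (forall L, exists P, [/\ one_stable sigma L P, P 0 & (M sigma P <= 0)%E]) ->
  OneMinM sigma = 0%E.
Proof.
move=> h; rewrite /OneMinM (_ : OneMinM_at sigma = fun=> 0%E).
  exact: lim_cst (@ereal_hausdorff R) _ _ _ _.
apply/funext => L; apply/eqP; rewrite eq_le; apply/andP; split.
  have [P [sP P0 MP]] := h L.
  by apply: le_trans MP; apply: ereal_inf_lbound; exists P.
by apply: le_ereal_inf_tmp => _ [P _ <-]; exact: M_ge0.
Qed.

Lemma admissible_disks (s : seq plane) r (U := disk_union [set` s] r) :
  admissible [set` s] r ->
  [/\ forall p, p \in s -> 0 <= r p <= 1,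
      forall p q, p \in s -> q \in s -> 0 < enorm (p - q) ->
        0 < r p -> 0 < r q -> r p + r q <= enorm (p - q),
      forall p q, p \in s -> q \in s -> 0 < r p -> 0 < r q ->
        enorm (p - q) + (r p + r q) <= ediam U &
      forall p, p \in s -> 0 < r p -> enorm p + r p <= origin_radius U].
Proof.
move=> [r01 _ rdis].
have bU : bounded_plane U.
  by apply: bounded_disk_union => p /r01/andP[].
have dU p : p \in s -> disk p (r p) `<=` U by move=> ps x px; exists p.
split=> [//|p q ps qs pq rp rq|p q ps qs rp rq|p ps rp].
- apply: disjoint_disks_le => //; apply: rdis => // pqE.
  by move: pq; rewrite pqE subrr enorm0 ltxx.
- by apply: ediam_disks => //; exact: dU.
- by apply: origin_radius_disk => //; exact: dU.
Qed.

Lemma ediam_ge0 A : bounded_plane A -> 0 <= ediam A.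
Proof.
move=> bA; have [[x Ax]|/nonemptyPn ->] := pselect (A !=set0);
  last by rewrite ediam0.
exact: le_trans (enorm_ge0 _) (ediam_ub _ _ _ bA Ax Ax).
Qed.

Lemma origin_radius_ge0 A : bounded_plane A -> 0 <= origin_radius A.
Proof.
move=> [K K0 AK]; apply: lb_le_inf; first by exists K.
by move=> t [/ltW].
Qed.

(** * The trapezoid: distances, stability and the bound on [M] *)

Section Trapezoid.
Variables (s x y h : R).
Hypothesis sb : 5 / 4 <= s <= 13 / 10.
Hypothesis xE : x = 2 - s.
Hypothesis yE : s * x + (s - 2^-1) * y = 1 + s / 2.
Hypothesis xyE : x * y = s ^+ 2 - 1.
Hypothesis y0 : 0 < y.
Hypothesis y1 : y <= 19 / 20.
Hypothesis hE : h ^+ 2 = 1 - ((y - x) / 2) ^+ 2.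

Local Notation pA := (0 : plane).
Local Notation pB := (((x - y) / 2, h) : plane).
Local Notation pC := (((x + y) / 2, h) : plane).
Local Notation pD := ((x, 0) : plane).

Definition trapezoid := [:: pA; pB; pC; pD].

Let dAB : enorm (pA - pB) = 1.
Proof. by apply: enormE => //=; rewrite !sub0r !sqrrN hE; field. Qed.

Let dCD : enorm (pC - pD) = 1.
Proof. by apply: enormE => //=; rewrite subr0 hE; field. Qed.

Let dAD : enorm (pA - pD) = x.
Proof.
have /andP[? ?] := sb.
by apply: enormE => /=; [rewrite xE; lra|ring].
Qed.

Let dBC : enorm (pB - pC) = y.
Proof. by apply: enormE => /=; [exact: ltW|field]. Qed.

Let dAC : enorm (pA - pC) = s.
Proof.
have /andP[? ?] := sb; apply: enormE => /=; first lra.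
(* The squared diagonal is [((x + y) / 2) ^+ 2 + h ^+ 2 = x * y + 1], which Ptolemy's relation [xyE]
   turns into [s ^+ 2]. *)
by rewrite !sub0r !sqrrN hE -[s ^+ 2](subrK 1) -xyE; field.
Qed.

Let dBD : enorm (pB - pD) = s.
Proof.
have /andP[? ?] := sb; apply: enormE => /=; first lra.
by rewrite subr0 hE -[s ^+ 2](subrK 1) -xyE; field.
Qed.

Lemma trapezoid_uniq : uniq trapezoid.
Proof.
have /andP[? ?] := sb.
have neq p q t : enorm (p - q) = t -> 0 < t -> (p == q) = false.
  by move=> pqE t0; apply/eqP => pq; move: t0; rewrite -pqE pq subrr enorm0 ltxx.
rewrite /= !inE.
rewrite (neq _ _ _ dAB) // (neq _ _ _ dAC) ?(neq _ _ _ dAD) ?(neq _ _ _ dBC) //;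
  rewrite ?(neq _ _ _ dBD) ?(neq _ _ _ dCD)//; rewrite ?xE; lra.
Qed.

(** The pair chosen for a vertex is the diagonal avoiding it. *)
Lemma trapezoid_one_stable L : one_stable (s / 2) L [set` trapezoid].
Proof.
have /andP[? ?] := sb.
have s2 : 2 * (s / 2) * 1 = s by field.
have xle1 : x <= 1 by rewrite xE; lra.
have yle1 : y <= 1 by move: y1; lra.
have mem : [/\ pA \in trapezoid, pB \in trapezoid, pC \in trapezoid
  & pD \in trapezoid] by rewrite /trapezoid !inE !eqxx !orbT.
case: mem => mA mB mC mD p /=; rewrite /trapezoid !inE => + _.
case/or4P => /eqP ->.
- exists (pB, pD); split=> //; split; rewrite /cdisk/= ?s2 ?dBD// enormBC ?dAB//.
  by rewrite dAD.
- exists (pA, pC); split=> //; split; rewrite /cdisk/= ?s2 ?dAC// ?dAB//.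
  by rewrite enormBC dBC.
- exists (pB, pD); split=> //; split; rewrite /cdisk/= ?s2 ?dBD// ?dBC//.
  by rewrite enormBC dCD.
- exists (pA, pC); split=> //; split; rewrite /cdisk/= ?s2 ?dAC// ?dCD//.
  by rewrite dAD.
Qed.

Lemma trapezoid_M : (M (s / 2) [set` trapezoid] <= 0)%E.
Proof.
have /andP[? ?] := sb.
have x0 : 0 < x by rewrite xE; lra.
have s0 : 0 < s by lra.
(* Equality holds: subtract [x / 2 = 1 - s / 2] from [yE]. *)
have sxy : (s - 2^-1) * (x + y) <= s by move: yE; rewrite xE; lra.
have [s1 sle2 xle1 yle1] : [/\ 1 <= s, s <= 2, x <= 1 & y <= 1].
  by split; rewrite ?xE; move: y1; lra.
apply: ge_ereal_sup => _ [r adm <-]; rewrite lee_fin.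
have [r01 sep diam rad] := admissible_disks _ _ adm.
have bU : bounded_plane (disk_union [set` trapezoid] r).
  by apply: bounded_disk_union => p /r01/andP[].
have [mA mB mC mD] : [/\ pA \in trapezoid, pB \in trapezoid, pC \in trapezoid
  & pD \in trapezoid] by rewrite /trapezoid !inE !eqxx !orbT.
have sumE : \sum_(p \in [set` trapezoid]) r p = r pA + r pB + r pC + r pD.
  (* Distinctness of the vertices lets the sum over the set expand into four terms. *)
  by rewrite -fsbig_seq ?trapezoid_uniq// unlock /= addr0 !addrA.
have nB : enorm pB = 1 by move: dAB; rewrite enormBC subr0.
have nC : enorm pC = s by move: dAC; rewrite enormBC subr0.
have nD : enorm pD = x by move: dAD; rewrite enormBC subr0.
have single p : p \in trapezoid -> 0 < r p ->
    2 * r p <= ediam (disk_union [set` trapezoid] r).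
  by move=> mp rp; have := diam p p mp mp rp rp; rewrite subrr enorm0; lra.
have /andP[a0 _] := r01 _ mA; have /andP[b0 _] := r01 _ mB.
have /andP[c0 _] := r01 _ mC; have /andP[d0 _] := r01 _ mD.
have sAB := sep _ _ mA mB; rewrite dAB in sAB; have {}sAB := sAB ltr01.
have sCD := sep _ _ mC mD; rewrite dCD in sCD; have {}sCD := sCD ltr01.
have sAD := sep _ _ mA mD; rewrite dAD in sAD; have {}sAD := sAD x0.
have sBC := sep _ _ mB mC; rewrite dBC in sBC; have {}sBC := sBC y0.
have sAC := sep _ _ mA mC; rewrite dAC in sAC; have {}sAC := sAC s0.
have sBD := sep _ _ mB mD; rewrite dBD in sBD; have {}sBD := sBD s0.
have tAB := diam _ _ mA mB; have tCD := diam _ _ mC mD; have tAD := diam _ _ mA mD.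
have tBC := diam _ _ mB mC; have tAC := diam _ _ mA mC; have tBD := diam _ _ mB mD.
rewrite dAB in tAB; rewrite dCD in tCD; rewrite dAD in tAD.
rewrite dBC in tBC; rewrite dAC in tAC; rewrite dBD in tBD.
have rA := rad _ mA; have rB := rad _ mB; have rC := rad _ mC; have rD := rad _ mD.
rewrite enorm0 add0r in rA; rewrite nB in rB; rewrite nC in rC; rewrite nD in rD.
have s2 : 2 * (s / 2) = s by field.
apply: F_le0; rewrite ?divr_gt0// s2 sumE.
- exact: (quad_diam_bound _ _ _ _ _ _ _ _ _ s1 sle2 xle1 yle1 sxy a0 b0 c0 d0
    (ediam_ge0 _ bU) sAB sCD sAD sBC sAC sBD (single _ mA) (single _ mB)
    (single _ mC) (single _ mD) tAB tCD tAD tBC tAC tBD).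
- exact: (quad_radius_bound _ _ _ _ _ _ _ _ _ sb xE yE y1 (r01 _ mA) (r01 _ mB)
    (r01 _ mC) (r01 _ mD) (origin_radius_ge0 _ bU) sAB sCD sAD sBC sAC sBD
    rA rB rC rD).
Qed.

End Trapezoid.

End Disks.

(** * Side lengths of the trapezoid at the root of the cubic *)

Theorem theorem3p5 (R : realType) (sigma : R)
  (sigma_gt0 : 0 < sigma)
  (sigma_root : 32 * sigma ^+ 3 - 32 * sigma ^+ 2 + 12 * sigma - 3 = 0) :
  OneMinM sigma = 0%E.
Proof.
have [t [t_bounds [_ t_uniq]]] := cubic_unique_root R.
have /andP[lo hi] : (64 + 368 / 1000) / 100 <= sigma < (64 + 369 / 1000) / 100.
  by rewrite -(t_uniq sigma (conj sigma_gt0 sigma_root)).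
clear t t_bounds t_uniq.
pose s := 2 * sigma; have sE : sigma = s / 2 by rewrite /s; field.
have s0 : 2 * s - 1 != 0 by rewrite gt_eqF// /s; lra.
have sb : 5 / 4 <= s <= 13 / 10 by rewrite /s; apply/andP; split; lra.
have s_root : 4 * s ^+ 3 - 8 * s ^+ 2 + 6 * s - 3 = 0.
  by rewrite -[RHS]sigma_root /s; ring.
have [x xE] : exists x : R, x = 2 - s by exists (2 - s).
(* This is twice the tight radius condition, solved for [y] with [x = 2 - s]. *)
have [y yE] : exists y : R, (2 * s - 1) * y = 2 * s ^+ 2 - 3 * s + 2.
  by exists ((2 * s ^+ 2 - 3 * s + 2) / (2 * s - 1)); field.
have y0 : 0 < y.
  by rewrite -(pmulr_rgt0 _ (_ : 0 < 2 * s - 1)) ?yE /s; nra.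
have y1 : y <= 19 / 20.
  by rewrite -(ler_pM2l (_ : 0 < 2 * s - 1)) ?yE /s; nra.
have xyE : x * y = s ^+ 2 - 1.
  (* After multiplication by [2 * s - 1], the two sides differ by minus the cubic in [s_root]. *)
  apply: (mulfI s0); rewrite mulrCA yE xE.
  by apply/eqP; rewrite -subr_eq0 -(oppr0 R) -s_root; apply/eqP; ring.
have hE : Num.sqrt (1 - ((y - x) / 2) ^+ 2) ^+ 2 = 1 - ((y - x) / 2) ^+ 2.
  rewrite sqr_sqrtr// (_ : 1 - _ = (1 - (y - x) / 2) * (1 + (y - x) / 2)).
    by apply: mulr_ge0; rewrite xE; lra.
  by ring.
have sxyE : s * x + (s - 2^-1) * y = 1 + s / 2 by rewrite xE; lra.
rewrite sE; apply: OneMinM_eq0 => L.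
exists [set` trapezoid R x y (Num.sqrt (1 - ((y - x) / 2) ^+ 2))]; split.
- exact: (trapezoid_one_stable R s).
- by rewrite /= /trapezoid inE eqxx.
- exact: (trapezoid_M R s).
Qed.
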